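(* A positive integer $m$ is a neo balcobalancing number if and only if $m^{2}-\frac{3m}{2}+1$ is a triangular number; more precisely, for every $n\ge1$, $$T_{B_{n}^{neobc}+R_{n}^{neobc}}=(B_{n}^{neobc})^{2}-\frac{3B_{n}^{neobc}}{2}+1,$$ where $T_k=\frac{k(k+1)}{2}$.
   Context: Triangular numbers: $T_k=\frac{k(k+1)}{2}$. A positive integer $m$ is a neo balcobalancing number if there is a positive integer $r$ (its neo balcobalancer) such that $(1+2+\cdots+(m-1))+(1+2+\cdots+m)=2[(m-1)+m+(m+1)+(m+2)+\cdots+(m+r)]$. $B_n^{neobc}$ denotes the $n$-th neo balcobalancing number in increasing order ($n\ge1$) and $R_n^{neobc}$ its neo balcobalancer. *)

(* Defs.v *)
From mathcomp Require Import all_boot all_order all_algebra.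
From mathcomp Require Import zify.
From mathcomp Require Import boolp classical_sets.

Set Implicit Arguments.
Unset Strict Implicit.
Unset Printing Implicit Defensive.

(* The summation range starts at m - 1, written m.-1; this is the genuine
   predecessor because 0 < m. *)
Definition neo_balcobalancer (m r : nat) : Prop :=
  [/\ 0 < m, 0 < r &
      \sum_(1 <= i < m) i + \sum_(1 <= i < m.+1) i =
      2 * \sum_(m.-1 <= i < (m + r).+1) i].

Definition neo_balcobalancing (m : nat) : Prop :=
  exists r, neo_balcobalancer m r.

Definition triangular (k : nat) : rat := (k%:R * (k%:R + 1) / 2)%R.

Definition is_triangular (x : rat) : Prop := exists k, x = triangular k.

Lemma double_sum_nat n : 2 * (\sum_(1 <= i < n.+1) i) = n * n.+1.
Proof.
elim: n => [|n IH]; first by rewrite big_geq.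
by rewrite big_nat_recr //= mulnDr IH; nia.
Qed.

Lemma double_sum_shift p r :
  2 * (\sum_(p <= i < (p.+1 + r).+1) i) + p * p.-1 =
  (p.+1 + r) * (p.+1 + r).+1.
Proof.
elim: r => [|r IH].
  rewrite addn0 big_nat_recr ?leqW //= big_nat1; case: p => [|p] /=; nia.
rewrite addnS big_nat_recr /=; last by lia.
rewrite mulnDr; nia.
Qed.

Lemma neo_balcobalancer_uniq m r s :
  neo_balcobalancer m r -> neo_balcobalancer m s -> r = s.
Proof.
case: m => [|p]; first by case.
move=> [_ _ er] [_ _ es]; move: er; rewrite es /=.
by have := double_sum_shift p r; have := double_sum_shift p s; nia.
Qed.

(* The map (m, k) |-> (17 m + 12 k - 6, 24 m + 17 k - 10) preserves the
   equation 2 m^2 + 2 = k (k + 1) + 3 m, which yields arbitrarily large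
   solutions from (6, 7); they are written below with m = p + 1 and
   k = p + 1 + r. *)
Lemma neo_balcobalancing_unbounded N :
  exists m, (N < m) && `[< neo_balcobalancing m >].
Proof.
have [p [r [lNp r0 e]]] : exists p r, [/\ N <= p, 0 < r &
    2 * p.+1 ^ 2 + 2 = (p.+1 + r) * (p.+1 + r).+1 + 3 * p.+1].
  elim: N => [|N [p [r [lNp r0 e]]]]; first by exists 5, 1.
  exists (29 * p + 12 * r + 22), (12 * p + 5 * r + 8).
  split; [lia | lia | nia].
exists p.+1; rewrite ltnS lNp; apply/asboolP; exists r; split=> //=.
have h1 := double_sum_nat p.
have h2 := double_sum_nat p.+1.
have h3 := double_sum_shift p r.
have h4 : p * p.-1 + p = p ^ 2 by case: (p) => [|q] /=; nia.
nia.
Qed.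

Definition next_neo_balcobalancing (N : nat) : nat :=
  ex_minn (neo_balcobalancing_unbounded N).

(* Numbering starts at 1: neoB 1 is the least neo balcobalancing number, and
   neoB 0 = 0 is only the seed of the recursion. *)
Definition neoB (n : nat) : nat := iter n next_neo_balcobalancing 0.

(* By neo_balcobalancer_uniq and neoB_balcobalancing, this is the unique
   balancer of neoB n when 0 < n; the default value 0 is reached only at
   n = 0. *)
Definition neoR (n : nat) : nat :=
  xget 0 [set r | neo_balcobalancer (neoB n) r]%classic.

Lemma neoB_balcobalancing n : 0 < n -> neo_balcobalancing (neoB n).
Proof.
case: n => // n _; rewrite /neoB iterS /next_neo_balcobalancing.
by case: ex_minnP => m /andP[_ /asboolP].
Qed.

Lemma neoB_ltS n : neoB n < neoB n.+1.
Proof.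
rewrite /neoB iterS /next_neo_balcobalancing.
by case: ex_minnP => m /andP[].
Qed.

Lemma neoB_surj m :
  neo_balcobalancing m -> exists2 n, 0 < n & neoB n = m.
Proof.
move=> hm.
have bnd n : n <= neoB n.
  by elim: n => // n IH; apply: leq_ltn_trans IH (neoB_ltS n).
have hex : exists n, m <= neoB n by exists m.
case: (ex_minnP hex) => -[|n] lmn nmin.
  by case: hm => r [m0 _ _]; move: lmn; rewrite leqn0 => /eqP m00; rewrite m00 in m0.
have lnm : neoB n < m by rewrite ltnNge; apply/negP => /nmin; rewrite ltnn.
exists n.+1 => //; apply/eqP; rewrite eqn_leq lmn andbT.
rewrite /neoB iterS -/(neoB n) /next_neo_balcobalancing.
case: ex_minnP => p _; apply; rewrite lnm; exact/asboolP.
Qed.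

Lemma neoR_balcobalancer n : 0 < n -> neo_balcobalancer (neoB n) (neoR n).
Proof. by move=> /neoB_balcobalancing[r hr]; exact: (xgetPex 0 (ex_intro _ r hr)). Qed.

(* Main.v *)
Require Import Defs.
From mathcomp Require Import all_boot all_order all_algebra.
From mathcomp Require Import zify lra.
Import GRing.Theory.

(** Both conditions reduce to the Diophantine equation
    [2 m^2 + 2 = k (k + 1) + 3 m] with [k = m + r]. The balancing condition also
    requires [r > 0], i.e. [k > m]; this is automatic, since the equation has no
    solution with [0 < m < 4], and [k (k + 1) = 2 m^2 - 3 m + 2 > m (m + 1)]
    for [m >= 4]. *)

(** With [k = m + r], the left side of the balancing equation is [m ^ 2], and the right side is
    [k (k + 1) - (m - 1) (m - 2)]. *)
Lemma neo_balcobalancerE m r : 0 < m ->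
  neo_balcobalancer m r <->
  0 < r /\ 2 * m ^ 2 + 2 = (m + r) * (m + r).+1 + 3 * m.
Proof.
case: m => // p _; rewrite /neo_balcobalancer /=.
have h1 := double_sum_nat p.
have h2 := double_sum_nat p.+1.
have h3 := double_sum_shift p r.
(* The truncation of [p.-1] at [p = 0] is harmless, being multiplied by [p]. *)
have h4 : p * p.-1 + p = p ^ 2 by case: (p) => [|q] /=; nia.
by split=> [[_ r0 e]|[r0 e]]; split=> //; nia.
Qed.

Lemma triangularE m k :
  triangular k = (m%:R ^+ 2 - 3 * m%:R / 2 + 1)%R <->
  2 * m ^ 2 + 2 = k * k.+1 + 3 * m.
Proof.
(* Without subtraction or division, the equation passes between [nat] and [rat] by injectivity of
   the cast. *)
have E : (2 * m ^ 2 + 2 = k * k.+1 + 3 * m) <->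
    (2 * m%:R ^+ 2 + 2 = k%:R * (k%:R + 1) + 3 * m%:R :> rat)%R.
  rewrite natr1 -!natrX -!natrM -!natrD; split=> [->//|/eqP].
  by rewrite Num.Theory.eqr_nat => /eqP.
rewrite E /triangular; split=> e; lra.
Qed.

Lemma ltn_triangular_root m k : 0 < m ->
  2 * m ^ 2 + 2 = k * k.+1 + 3 * m -> m < k.
Proof.
case: (leqP 4 m) => [m4 _ e|]; first by nia.
(* For [m] = 1, 2, 3 the product [k (k + 1)] would be 1, 4, 11, which is impossible. *)
by case: m => [|[|[|[|m]]]] // _ _; case: k => [|[|[|[|k]]]] //; nia.
Qed.

Theorem theorem6p1 :
  (forall m : nat, 0 < m ->
     (neo_balcobalancing m <->
      is_triangular (m%:R ^+ 2 - 3 * m%:R / 2 + 1)%R)) /\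
  (forall n : nat, 1 <= n ->
     triangular (neoB n + neoR n) =
     ((neoB n)%:R ^+ 2 - 3 * (neoB n)%:R / 2 + 1)%R).
Proof.
split=> [m m0|n n0]; last first.
  have b := neoR_balcobalancer n0; have [m0 _ _] := b.
  by apply/triangularE; have [_] := (neo_balcobalancerE _ _ m0).1 b.
split=> [[r /(neo_balcobalancerE _ _ m0)[_ e]]|[k /esym/triangularE e]].
  by exists (m + r); apply/esym/triangularE.
have mk := ltn_triangular_root _ _ m0 e.
exists (k - m); apply/neo_balcobalancerE => //.
by rewrite subn_gt0 subnKC // ltnW.
Qed.
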